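(* Let $p\ge3$ and $\ell\ge5$ be distinct primes with $p^2\mid N$, $\ell\nmid N$, and suppose the inertial type at $p$ is non-exceptional supercuspidal with $K/\mathbb{Q}_p$ unramified (with $f$, $N$, $\bar\rho$, $K$ as in the context). Then: (i) if $p\not\equiv\pm1\pmod\ell$, then $\dim_\kappa H^0(G_p,\bar\varepsilon_\ell\otimes\mathrm{ad}^0\bar\rho)=0$; (ii) if $p\equiv-1\pmod\ell$, then $\dim_\kappa H^0(G_p,\bar\varepsilon_\ell\otimes\mathrm{ad}^0\bar\rho)=1$, generated by the class corresponding to $\varepsilon_K$ in the $(\bar\varepsilon_\ell\cdot\varepsilon_K)$-summand of $\bar\varepsilon_\ell\otimes\mathrm{ad}^0\bar\rho|_{G_p}$; (iii) if $p\equiv1\pmod\ell$, then $\dim_\kappa H^0(G_p,\bar\varepsilon_\ell\otimes\mathrm{ad}^0\bar\rho)=0$.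
   Context: $f$ is a normalized weight $2$ newform of level $N$ corresponding to an elliptic curve $E_f/\mathbb{Q}$ of conductor $N$, $\kappa$ is a finite field of characteristic $\ell$, $S$ is a finite set of places of $\mathbb{Q}$ containing $\infty$ and the primes dividing $N\ell$, and $\bar\rho:G_{\mathbb{Q},S}\to\mathrm{GL}_2(\kappa)$ is the residual representation attached to $f$. Throughout: $\bar\rho$ is odd, continuous and absolutely irreducible, $f$ is ordinary at $\ell$ ($a_\ell(f)\not\equiv0\bmod\ell$), and the deformation problem for $\bar\rho$ is minimally ramified at all primes dividing $N$; at a prime $p$ of supercuspidal type this means that deformations restricted to $G_p$ are of the form $\mathrm{Ind}_{G_K}^{G_p}\chi$ with $\chi$ a lift of $\bar\chi$ (below) of the same conductor exponent. $G_p\supseteq I_p$ are decomposition and inertia groups at $p$, $\mathrm{Frob}_p$ is arithmetic Frobenius; $\bar\varepsilon_\ell$ is the mod $\ell$ cyclotomic character; $\mathrm{ad}^0\bar\rho$ is the space of trace-zero $2\times2$ matrices over $\kappa$ with conjugation action via $\bar\rho$. $E_f$ has additive, potentially good reduction at $p$. $\tau_{\mathrm{sc},p}(d,c,r)$ denotes the inertial type of $\mathrm{Ind}_{G_K}^{G_p}\chi$ with $K=\mathbb{Q}_p(\sqrt d)$, $\chi$ of conductor exponent $c$ and order $r$ on $I_K$. The types with $K$ unramified are: for $p\ge5$, $\tau_{\mathrm{sc},p}(u,1,e)$ with $u$ a non-square unit, $e\in\{3,4,6\}$, $e\mid p+1$; for $p=3$, $\tau_{\mathrm{sc},3}(-1,1,4)$,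 $\tau_{\mathrm{sc},3}(-1,2,3)$ and $\tau_{\mathrm{sc},3}(-1,2,3)\otimes\varepsilon_3$, with $\varepsilon_3$ the quadratic character of $\mathbb{Q}_3(\sqrt3)/\mathbb{Q}_3$. Residually $\bar\rho|_{G_p}\cong\mathrm{Ind}_{G_K}^{G_p}\bar\chi$ with $\bar\chi\ne\bar\chi^s$, $\bar\chi^s(g)=\bar\chi(\mathrm{Frob}_p^{-1}g\,\mathrm{Frob}_p)$. $\varepsilon_K$ is the quadratic character of $G_p$ attached to $K/\mathbb{Q}_p$ (so $\varepsilon_K|_{I_p}=1$, $\varepsilon_K(\mathrm{Frob}_p)=-1$), and $$\bar\varepsilon_\ell\otimes\mathrm{ad}^0\bar\rho|_{G_p}\cong(\bar\varepsilon_\ell\cdot\varepsilon_K)\oplus(\bar\varepsilon_\ell\otimes\mathrm{Ind}_{G_K}^{G_p}\bar\psi),\qquad \bar\psi=\bar\chi/\bar\chi^s.$$ *)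

(* Defs.v *)
From HB Require Import structures.
From mathcomp Require Export all_boot all_order all_algebra all_field.
From mathcomp Require Export finmap.
From mathcomp Require Export all_classical all_reals all_analysis.
From mathcomp.real_closed Require Export complex.
Export Order.TTheory GRing.Theory Num.Theory numFieldNormedType.Exports.

Set Implicit Arguments.
Unset Strict Implicit.
Unset Printing Implicit Defensive.

Local Open Scope classical_set_scope.
Local Open Scope ring_scope.

(* This is 0 when [A] is infinite; it is only used for finite [A]. *)
Definition card_set (T : choiceType) (A : set T) : nat := #|` fset_set A |.

Section ModularForms.
Variable R : realType.
Local Notation C := R[i].

Definition upper_half_plane : set C := [set z | 0 < complex.Im z].

Definition SL2Z : set 'M[int]_2 := [set g | \det g = 1].

Definition Gamma0 (N : nat) : set 'M[int]_2 :=
  [set g | \det g = 1 /\ (N %| g 1%R 0%R)%Z].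

Definition automorphy (g : 'M[int]_2) (z : C) : C :=
  (g 1 0)%:~R * z + (g 1 1)%:~R.

Definition moebius (g : 'M[int]_2) (z : C) : C :=
  ((g 0 0)%:~R * z + (g 0 1)%:~R) / automorphy g z.

Definition slash2 (f : C -> C) (g : 'M[int]_2) (z : C) : C :=
  (automorphy g z ^+ 2)^-1 * f (moebius g z).

(* [derivable] over the field [C] is complex differentiability; the limit in
   the last clause is uniform in the real part of [z], i.e. the q-expansion of
   [slash2 f g] has only positive powers. *)
Record cusp_form2 (N : nat) (f : C -> C) : Prop := {
  cf_holomorphic : forall z : C, upper_half_plane z ->
    derivable (f : C^o -> C^o) (z : C^o) (1 : C^o);
  cf_modular : forall g z, Gamma0 N g -> upper_half_plane z ->
    slash2 f g z = f z;
  cf_cusps : forall g, SL2Z g -> forall e : R, 0 < e ->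
    exists B : R, forall z, upper_half_plane z -> B < complex.Im z ->
      complex.Re `|slash2 f g z| < e }.

(* [qpow n z = exp (2 pi i n z)] *)
Definition qpow (n : nat) (z : C) : C :=
  let t := 2 * trigo.pi * n%:R in
  Complex (expR (- (t * complex.Im z)) * cos (t * complex.Re z))
          (expR (- (t * complex.Im z)) * sin (t * complex.Re z)).

Definition fourier_coefs (f : C -> C) (a : nat -> C) : Prop :=
  forall z, upper_half_plane z ->
    (fun n : nat => (\sum_(0 <= k < n) a k * qpow k z) : C^o) @ \oo
      --> (f z : C^o).

(* The operator T_q for q not dividing N, and U_q for q dividing N. *)
Definition hecke (N q : nat) (f : C -> C) (z : C) : C :=
  q%:R^-1 * (\sum_(j < q) f ((z + j%:R) / q%:R))
  + (if (q %| N)%N then 0 else q%:R * f (q%:R * z)).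

Definition coset_reps (N : nat) (rs : seq 'M[int]_2) : Prop :=
  [/\ uniq rs, (forall g, g \in rs -> SL2Z g)
    & forall g, SL2Z g ->
        exists! r, r \in rs /\ exists2 h, Gamma0 N h & g = h *m r].

Definition fundamental_domain : set (R * R) :=
  [set xy | [/\ `|xy.1| <= 2^-1, 1 <= xy.1 ^+ 2 + xy.2 ^+ 2 & 0 < xy.2]].

Definition complex_integral (D : set (R * R)) (h : R * R -> C) : C :=
  let mu := (lebesgue_measure \x lebesgue_measure)%E in
  Complex (Rintegral mu D (fun xy => complex.Re (h xy)))
          (Rintegral mu D (fun xy => complex.Im (h xy))).

(* The integral of f(z) conj(g(z)) dx dy over the fundamental domain of
   Gamma0(N) made of the translates of the standard one by [rs]; in weight 2
   the factor y^2 cancels against the hyperbolic measure dx dy / y^2. *)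
Definition petersson (rs : seq 'M[int]_2) (f g : C -> C) : C :=
  \sum_(r <- rs) complex_integral fundamental_domain
    (fun xy => slash2 f r (Complex xy.1 xy.2)
               * (slash2 g r (Complex xy.1 xy.2))^*%C).

(* Orthogonality to the forms g(tz) spanning the old subspace. *)
Definition new_at (N : nat) (f : C -> C) : Prop :=
  forall (M t : nat) (g : C -> C) (rs : seq 'M[int]_2),
    (M %| N)%N -> M != N -> (t %| N %/ M)%N -> cusp_form2 M g ->
    coset_reps N rs -> petersson rs f (fun z => g (t%:R * z)) = 0.

Record normalized_newform2 (N : nat) (f : C -> C) (a : nat -> C) : Prop := {
  nf_level : (0 < N)%N;
  nf_cusp : cusp_form2 N f;
  nf_coefs : fourier_coefs f a;
  nf_normalized : a 0%N = 0 /\ a 1%N = 1;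
  nf_eigen : forall q, prime q -> exists c : C,
    forall z, upper_half_plane z -> hecke N q f z = c * f z;
  nf_new : new_at N f }.

End ModularForms.

(* Every ring endomorphism of the algebraic closure [algC] of Q is an
   automorphism, with inverse [algC_invaut]. *)
Notation GalQ := {rmorphism algC -> algC}.

Definition gal_one : GalQ := idfun : {rmorphism algC -> algC}.
Definition gal_mul (s t : GalQ) : GalQ := (s \o t : {rmorphism algC -> algC}).
Definition gal_inv (s : GalQ) : GalQ :=
  (algC_invaut s : {rmorphism algC -> algC}).
Definition complex_conjugation : GalQ :=
  (Num.conj : {rmorphism algC -> algC}).

Definition fixes (s : seq algC) (g : GalQ) : Prop := {in s, forall x, g x = x}.

(* Prime ideals of the ring [Aint] of all algebraic integers.  Such an ideal
   amounts to an embedding of [algC] into an algebraic closure of Q_q, up to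
   the Galois group of Q_q, and its decomposition group to that group. *)
Record prime_ideal_above (q : nat) (P : {pred algC}) : Prop := {
  pa_int : {subset P <= Aint};
  pa_add : {in P &, forall x y, x + y \in P};
  pa_mul : {in Aint & P, forall x y, x * y \in P};
  pa_prime : {in Aint &, forall x y, x * y \in P -> (x \in P) || (y \in P)};
  pa_proper : 1 \notin P;
  pa_above : q%:R \in P }.

Definition decomposition (P : {pred algC}) : set GalQ :=
  [set g | forall x, (g x \in P) = (x \in P)].

Definition inertia (P : {pred algC}) : set GalQ :=
  [set g | decomposition P g /\ {in Aint, forall x, g x - x \in P}].

Definition arithmetic_frobenius (q : nat) (P : {pred algC}) (g : GalQ) : Prop :=
  decomposition P g /\ {in Aint, forall x, g x - x ^+ q \in P}.

(* The subfield Q(s) of [algC]. *)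
Definition in_field_gen (s : seq algC) (x : algC) : Prop :=
  forall F : {pred algC}, divring_closed F -> {subset s <= F} -> x \in F.

Definition normal_gen (s : seq algC) : Prop :=
  forall (g : GalQ) x, x \in s -> in_field_gen s (g x).

(* The [n]-th power, for [n > 0], of the prime below [P] in the ring of
   integers of Q(s). *)
Definition prime_power_in (P : {pred algC}) (s : seq algC) (n : nat)
    (x : algC) : Prop :=
  exists t : seq (n.-tuple algC),
    {in t, forall u, {in u, forall y, y \in P /\ in_field_gen s y}}
    /\ x = \sum_(u <- t) \prod_(y <- u) y.

(* For Q(s) normal over Q this is the inverse image in the inertia group of [P]
   of the [i]-th ramification group of Q(s)/Q. *)
Definition ramification (P : {pred algC}) (s : seq algC) (i : nat) : set GalQ :=
  [set g | inertia P g /\ forall x, x \in Aint -> in_field_gen s x ->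
     prime_power_in P s i.+1 (g x - x)].

(* Elements of Gal(Q(s)/Q) are encoded by the images of the generators. *)
Definition ramification_card (P : {pred algC}) (s : seq algC) (i : nat) : nat :=
  card_set [set map (g : algC -> algC) s | g in ramification P s i].

(* Artin conductor exponent of a character of the Galois group of an unramified
   extension of Q_p: it only depends on the restriction to inertia, which is
   the inertia group of Q_p itself, and the lower numbering over Q_p is used. *)
Definition conductor_exponent (A : nzRingType) (P : {pred algC})
    (chi : GalQ -> A) (c : nat) : Prop :=
  exists s : seq algC,
    [/\ normal_gen s,
        (forall g, inertia P g -> fixes s g -> chi g = 1)
      & exists B : nat,
          (forall i g, (B <= i)%N -> ramification P s i g -> chi g = 1)
          /\ \sum_(i < B)
               (if `[< forall g, ramification P s i g -> chi g = 1 >] then 0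
                else (ramification_card P s i)%:R
                       / (ramification_card P s 0)%:R) = c%:R :> rat].

Record weierstrass (A : Type) := Weierstrass {
  wa1 : A; wa2 : A; wa3 : A; wa4 : A; wa6 : A }.

Definition map_weierstrass (A B : Type) (h : A -> B) (W : weierstrass A) :=
  Weierstrass (h (wa1 W)) (h (wa2 W)) (h (wa3 W)) (h (wa4 W)) (h (wa6 W)).

Section Weierstrass.
Variable A : comNzRingType.
Implicit Type W : weierstrass A.

Definition wb2 W := wa1 W ^+ 2 + 4 * wa2 W.
Definition wb4 W := 2 * wa4 W + wa1 W * wa3 W.
Definition wb6 W := wa3 W ^+ 2 + 4 * wa6 W.
Definition wb8 W := wa1 W ^+ 2 * wa6 W + 4 * wa2 W * wa6 W
  - wa1 W * wa3 W * wa4 W + wa2 W * wa3 W ^+ 2 - wa4 W ^+ 2.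
Definition wc4 W := wb2 W ^+ 2 - 24 * wb4 W.
Definition wdisc W := - wb2 W ^+ 2 * wb8 W - 8 * wb4 W ^+ 3
  - 27 * wb6 W ^+ 2 + 9 * wb2 W * wb4 W * wb6 W.

Definition weq W (x y : A) : Prop :=
  y ^+ 2 + wa1 W * x * y + wa3 W * y
    = x ^+ 3 + wa2 W * x ^+ 2 + wa4 W * x + wa6 W.

(* [W'] is obtained from [W] by x = u^2 x' + r, y = u^3 y' + u^2 s x' + t. *)
Definition wchange W W' (u r s t : A) : Prop :=
  [/\ u * wa1 W' = wa1 W + 2 * s,
      u ^+ 2 * wa2 W' = wa2 W - s * wa1 W + 3 * r - s ^+ 2,
      u ^+ 3 * wa3 W' = wa3 W + r * wa1 W + 2 * t,
      u ^+ 4 * wa4 W' = wa4 W - s * wa3 W + 2 * r * wa2 W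
         - (t + r * s) * wa1 W + 3 * r ^+ 2 - 2 * s * t
    & u ^+ 6 * wa6 W' = wa6 W + r * wa4 W + r ^+ 2 * wa2 W + r ^+ 3
         - t * wa3 W - t ^+ 2 - r * t * wa1 W].

End Weierstrass.

(* An elliptic curve over Q, given by a global minimal Weierstrass equation. *)
Definition minimal_elliptic_curve (E : weierstrass int) : Prop :=
  wdisc E != 0 /\
  forall (E' : weierstrass int) (u r s t : rat), u != 0 ->
    wchange (map_weierstrass intr E) (map_weierstrass intr E') u r s t ->
    `|wdisc E| <= `|wdisc E'|.

(* [q + 1] minus the number of points (including infinity and, if there is
   one, the singular point) of the reduction at [q]; for multiplicative or
   additive reduction this is 1, -1 or 0. *)
Definition trace_of_frobenius (E : weierstrass int) (q : nat) : int :=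
  q%:Z - (#|[pred xy : 'F_q * 'F_q |
             `[< weq (map_weierstrass intr E) xy.1 xy.2 >]]|)%:Z.

Definition good_reduction (E : weierstrass int) (q : nat) : bool :=
  ~~ (q %| wdisc E)%Z.
Definition multiplicative_reduction (E : weierstrass int) (q : nat) : bool :=
  (q %| wdisc E)%Z && ~~ (q %| wc4 E)%Z.
Definition additive_reduction (E : weierstrass int) (q : nat) : bool :=
  (q %| wdisc E)%Z && (q %| wc4 E)%Z.

Definition integral_at (P : {pred algC}) (x : algC) : Prop :=
  exists a b, [/\ a \in Aint, b \in Aint, b \notin P & x = a / b].

(* Good reduction over some finite extension: an integral model at [P], over
   [algC], whose discriminant is a unit at [P]. *)
Definition potentially_good_reduction (E : weierstrass int)
    (P : {pred algC}) : Prop :=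
  exists (E' : weierstrass algC) (u r s t : algC),
    [/\ u != 0, wchange (map_weierstrass intr E) E' u r s t,
        [/\ integral_at P (wa1 E'), integral_at P (wa2 E'),
            integral_at P (wa3 E'), integral_at P (wa4 E')
          & integral_at P (wa6 E')],
        wdisc E' != 0 & integral_at P (wdisc E')^-1].

(* Points over [algC]; [None] is the point at infinity. *)
Definition wpoint := option (algC * algC).

Section Points.
Variable E : weierstrass algC.

Definition on_curve (Q : wpoint) : Prop :=
  if Q is Some (x, y) then weq E x y else True.

Definition wadd (Q1 Q2 : wpoint) : wpoint :=
  match Q1, Q2 with
  | None, _ => Q2
  | _, None => Q1
  | Some (x1, y1), Some (x2, y2) =>
    if (x1 == x2) && (y1 + y2 + wa1 E * x2 + wa3 E == 0) then None else
    let l := if x1 == x2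
      then (3 * x1 ^+ 2 + 2 * wa2 E * x1 + wa4 E - wa1 E * y1)
             / (2 * y1 + wa1 E * x1 + wa3 E)
      else (y2 - y1) / (x2 - x1) in
    let x3 := l ^+ 2 + wa1 E * l - wa2 E - x1 - x2 in
    Some (x3, - (l + wa1 E) * x3 - (y1 - l * x1) - wa3 E)
  end.

Definition torsion (m : nat) : set wpoint :=
  [set Q | on_curve Q /\ iter m (wadd Q) None = None].

End Points.

Definition gal_point (g : GalQ) (Q : wpoint) : wpoint :=
  if Q is Some (x, y) then Some (g x, g y) else None.

(* Generators of the field Q(E[m]). *)
Definition torsion_coords (E : weierstrass algC) (m : nat) : seq algC :=
  flatten [seq (if Q is Some (x, y) then [:: x; y] else [::])
          | Q <- fset_set (torsion E m)].

Definition torsion_fixed (E : weierstrass algC) (m : nat) (G : set GalQ) :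
    set wpoint :=
  [set Q | torsion E m Q /\ forall g, G g -> gal_point g Q = Q].

(* delta_q(E) = sum_{i >= 1} |G_i|/|G_0| dim (E[m] / E[m]^{G_i}), for any
   auxiliary prime m != q, with G_i the ramification groups at q of
   Q(E[m])/Q. *)
Definition wild_exponent (E : weierstrass int) (q delta : nat) : Prop :=
  let W := map_weierstrass intr E : weierstrass algC in
  exists (m : nat) (Q : {pred algC}),
    [/\ prime m, m != q, prime_ideal_above q Q
      & let s := torsion_coords W m in
        exists B : nat,
          (forall i, (B <= i)%N ->
             torsion_fixed W m (ramification Q s i) = torsion W m)
          /\ \sum_(1 <= i < B)
               (ramification_card Q s i)%:R / (ramification_card Q s 0)%:R
               * (2 - (logn m (card_set
                    (torsion_fixed W m (ramification Q s i))))%:R)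
             = delta%:R :> rat].

Definition conductor_at (E : weierstrass int) (q c : nat) : Prop :=
  [\/ good_reduction E q /\ c = 0%N,
      multiplicative_reduction E q /\ c = 1%N
    | additive_reduction E q /\
      exists2 delta, wild_exponent E q delta & c = (2 + delta)%N].

Definition conductor (E : weierstrass int) (N : nat) : Prop :=
  (0 < N)%N /\ forall q, prime q -> conductor_at E q (logn q N).

Definition is_representation (A : comUnitRingType) (rho : GalQ -> 'M[A]_2) :
    Prop :=
  rho gal_one = 1%:M /\ forall g h, rho (gal_mul g h) = rho g *m rho h.

Definition discrete_continuous (A : nzRingType) (rho : GalQ -> 'M[A]_2) :
    Prop :=
  exists s, forall g, fixes s g -> rho g = 1%:M.

Definition unramified_at (A : nzRingType) (rho : GalQ -> 'M[A]_2) (q : nat) :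
    Prop :=
  forall Q g, prime_ideal_above q Q -> inertia Q g -> rho g = 1%:M.

Definition odd_representation (A : comNzRingType) (rho : GalQ -> 'M[A]_2) :
    Prop :=
  \det (rho complex_conjugation) = -1.

(* No stable line (in row vectors) after any extension of scalars. *)
Definition absolutely_irreducible (k : fieldType) (rho : GalQ -> 'M[k]_2) :
    Prop :=
  forall (F : fieldType) (i : {rmorphism k -> F}) (v : 'rV[F]_2), v != 0 ->
    ~ forall g, exists c : F, v *m map_mx i (rho g) = c *: v.

(* With [n = ell] and values in a ring of characteristic [ell], this
   determines [eps] as the mod [ell] cyclotomic character. *)
Definition mod_cyclotomic (A : nzRingType) (n : nat) (eps : GalQ -> A) : Prop :=
  forall (g : GalQ) (z : algC) (m : nat),
    n.-primitive_root z -> g z = z ^+ m -> eps g = m%:R.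

(* [O] is the ring of integers of a finite extension of Q_ell, where ell is the
   characteristic of [k], with uniformizer [pi] and reduction map [red]: a
   complete discrete valuation ring of characteristic 0 with finite residue
   field. *)
Record local_integers (O : idomainType) (k : finFieldType)
    (red : {rmorphism O -> k}) (pi : O) : Prop := {
  li_char0 : [pchar O] =i pred0;
  li_surj : forall y, exists x, red x = y;
  li_ker : forall x, red x = 0 <-> exists y, x = pi * y;
  li_unif : pi != 0;
  li_val : forall x, x != 0 ->
    exists n, exists2 w, w \is a GRing.unit & x = pi ^+ n * w;
  li_complete : forall u : nat -> O,
    (forall n, exists y, u n.+1 - u n = pi ^+ n * y) ->
    exists x, forall n, exists y, u n - x = pi ^+ n * y }.

(* The lambda-adic representation attached to a weight 2 newform of level [N],
   trivial nebentypus and rational Fourier coefficients [a]. *)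
Record attached_representation (R : realType) (N : nat) (a : nat -> R[i])
    (ell : nat) (O : idomainType) (pi : O) (rho : GalQ -> 'M[O]_2) : Prop := {
  ar_rep : is_representation rho;
  ar_continuous : forall n, exists s, forall g, fixes s g ->
    exists Y : 'M[O]_2, rho g - 1%:M = pi ^+ n *: Y;
  ar_unramified : forall q, prime q -> ~~ (q %| N * ell)%N ->
    unramified_at rho q;
  ar_trace : forall q Q g (m : int), prime q -> ~~ (q %| N * ell)%N ->
    prime_ideal_above q Q -> arithmetic_frobenius q Q g ->
    a q = m%:~R -> \tr (rho g) = m%:~R;
  ar_det : forall n (g : GalQ) (z : algC) m,
    (ell ^ n).-primitive_root z -> g z = z ^+ m ->
    exists y : O, \det (rho g) - m%:R = (ell ^ n)%:R * y }.

(* [rhobar], with coefficients in [kappa], is after extension of scalars to the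
   residue field the reduction of [rho]. *)
Definition residual_of (kappa k' : finFieldType)
    (iota : {rmorphism kappa -> k'}) (O : idomainType)
    (red : {rmorphism O -> k'}) (rho : GalQ -> 'M[O]_2)
    (rhobar : GalQ -> 'M[kappa]_2) : Prop :=
  exists2 A : 'M[k']_2, A \in unitmx
    & forall g, map_mx iota (rhobar g) = A *m map_mx red (rho g) *m invmx A.

Definition rootd (d : int) : algC := sqrtC d%:~R.

Definition decomposition_K (P : {pred algC}) (d : int) : set GalQ :=
  [set g | decomposition P g /\ g (rootd d) = rootd d].

(* The quadratic character cut out by the square root of [d]. *)
Definition quad_char (A : nzRingType) (d : int) (g : GalQ) : A :=
  if g (rootd d) == rootd d then 1 else -1.

(* Only the values on [G] matter. *)
Definition continuous_character (O : idomainType) (pi : O) (G : set GalQ)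
    (chi : GalQ -> O) : Prop :=
  [/\ chi gal_one = 1,
      (forall g h, G g -> G h -> chi (gal_mul g h) = chi g * chi h)
    & forall n, exists s, forall g, G g -> fixes s g ->
        exists y, chi g - 1 = pi ^+ n * y].

Definition has_order_on (A : nzRingType) (G : set GalQ) (chi : GalQ -> A)
    (r : nat) : Prop :=
  [/\ (0 < r)%N, (forall g, G g -> chi g ^+ r = 1)
    & forall m, (0 < m < r)%N -> exists2 g, G g & chi g ^+ m != 1].

Definition conj_char (A : Type) (s : GalQ) (chi : GalQ -> A) (g : GalQ) : A :=
  chi (gal_mul (gal_inv s) (gal_mul g s)).

(* The matrix of Ind_{G_K}^{G_p} chi with respect to the coset representatives
   1 and [s] of G_K in G_p. *)
Definition induced_mx (A : nzRingType) (d : int) (s : GalQ) (chi : GalQ -> A)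
    (g : GalQ) : 'M[A]_2 :=
  \matrix_(i, j)
    let rep (k : 'I_2) : GalQ := if k == 0 then gal_one else s in
    let h := gal_mul (gal_inv (rep i)) (gal_mul g (rep j)) in
    if h (rootd d) == rootd d then chi h else 0.

Definition nonsquare_unit (p : nat) (d : int) : Prop :=
  ~~ (p %| d)%Z /\ forall x : int, ~~ (p %| x ^+ 2 - d)%Z.

(* Ind chi has inertial type tau_{sc,p}(d,c,r).  For K/Q_p unramified,
   I_K = I_p. *)
Definition tau_sc (O : idomainType) (pi : O) (P : {pred algC}) (d : int)
    (c r : nat) (chi : GalQ -> O) : Prop :=
  [/\ continuous_character pi (decomposition_K P d) chi,
      conductor_exponent P chi c
    & has_order_on (inertia P) chi r].

(* The twist by eps_3 is written on the character:
   (Ind chi0) (x) eps_3 = Ind (chi0 . eps_3|_{G_K}). *)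
Definition unramified_supercuspidal (O : idomainType) (pi : O)
    (P : {pred algC}) (p : nat) (d : int) (chi : GalQ -> O) : Prop :=
  [/\ (5 <= p)%N, nonsquare_unit p d
    & exists e, [/\ e \in [:: 3; 4; 6]%N, (e %| p.+1)%N
                  & tau_sc pi P d 1 e chi]]
  \/ [/\ p = 3%N, d = -1
    & [\/ tau_sc pi P d 1 4 chi,
          tau_sc pi P d 2 3 chi
        | exists2 chi0, tau_sc pi P d 2 3 chi0
          & forall g, decomposition_K P d g ->
              chi g = chi0 g * quad_char O 3 g]].

(* rho|I_p and (Ind chi)|I_p are isomorphic over the fraction field of [O]; the
   intertwining matrix is scaled so as to have entries in [O]. *)
Definition has_inertial_type (O : idomainType) (P : {pred algC}) (d : int)
    (s : GalQ) (rho : GalQ -> 'M[O]_2) (chi : GalQ -> O) : Prop :=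
  exists2 A : 'M[O]_2, \det A != 0
    & forall g, inertia P g -> rho g *m A = A *m induced_mx d s chi g.

Definition twisted_ad (k : fieldType) (eps : GalQ -> k) (rho : GalQ -> 'M[k]_2)
    (g : GalQ) (X : 'M[k]_2) : 'M[k]_2 :=
  eps g *: (rho g *m X *m invmx (rho g)).

Definition H0_invariant (k : fieldType) (G : set GalQ) (eps : GalQ -> k)
    (rho : GalQ -> 'M[k]_2) (X : 'M[k]_2) : Prop :=
  \tr X = 0 /\ forall g, G g -> twisted_ad eps rho g X = X.

Definition H0_ad0 (k : finFieldType) (G : set GalQ) (eps : GalQ -> k)
    (rho : GalQ -> 'M[k]_2) : {vspace 'M[k]_2} :=
  <<enum [pred X | `[< H0_invariant G eps rho X >]]>>%VS.

Lemma H0_ad0P (k : finFieldType) (G : set GalQ) (eps : GalQ -> k)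
    (rho : GalQ -> 'M[k]_2) (X : 'M[k]_2) :
  X \in H0_ad0 G eps rho <-> H0_invariant G eps rho X.
Proof.
have enumP Y : Y \in enum [pred Y | `[< H0_invariant G eps rho Y >]] <->
    H0_invariant G eps rho Y.
  by rewrite mem_enum; split=> [/asboolP|?] //; apply/asboolP.
split=> [XH|/enumP]; last exact: memv_span.
rewrite (coord_span XH).
apply: (@big_ind _ (H0_invariant G eps rho)) => [|Y Z [tY hY] [tZ hZ]|i _].
- split=> [|g _]; first by rewrite mxtrace0.
  by rewrite /twisted_ad mulmx0 mul0mx scaler0.
- split=> [|g Gg]; first by rewrite mxtraceD tY tZ addr0.
  rewrite -[in RHS](hY g Gg) -[in RHS](hZ g Gg).
  by rewrite /twisted_ad mulmxDr mulmxDl scalerDr.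
- have si : (i < size (enum [pred Y | `[< H0_invariant G eps rho Y >]]))%N.
    by rewrite -cardE.
  have /enumP[tY hY] := mem_nth 0 si.
  split=> [|g Gg]; first by rewrite mxtraceZ tY mulr0.
  rewrite -[in RHS](hY g Gg) /twisted_ad -scalemxAr -scalemxAl.
  by rewrite !scalerA mulrC.
Qed.

(* In the decomposition of ad^0 (Ind chi) into diagonal and antidiagonal
   matrices, the first summand is the line of diag(1,-1), on which G_K acts
   trivially and the elements outside G_K by -1; it is transported by the
   isomorphism given by conjugation by [B]. *)
Definition epsK_summand (k : fieldType) (B : 'M[k]_2) : {vspace 'M[k]_2} :=
  <[(B *m diag_mx (\row_(j < 2) (if j == 0 then 1 else -1)) *m invmx B)%R]>%VS.

(* Main.v *)
(* Conjugation by [B] turns an invariant of eps (x) ad^0 rhobar into a traceless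
   matrix X with eps(g) I(g) X = X I(g) for all g in G_p, where I = Ind chibar.
   On inertia eps = 1, and det rho = 1 modulo ell, so that chi^s = chi^-1 there
   modulo ell; since chi has order 3, 4 or 6 on inertia, which is prime to ell,
   some g0 in inertia has I(g0) diagonal with distinct entries.  Hence X is a
   multiple of diag(1,-1), and Frobenius, of eigenvalue -p on this line, kills
   it unless p = -1 mod ell.  If p = -1 mod ell, then eps = eps_K on G_p, so that
   the line of diag(1,-1) is invariant; 2 rhobar(g0) - tr rhobar(g0) spans it
   over [kappa]. *)
Require Import Defs.
From mathcomp Require Import ring zify.

Set Implicit Arguments.
Unset Strict Implicit.
Unset Printing Implicit Defensive.

Local Open Scope ring_scope.

(** * Group laws for the absolute Galois group of Q *)

Lemma gal_ext (g h : GalQ) : g =1 h -> g = h.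
Proof.
case: g => g [[g1] [g2]]; case: h => h [[h1] [h2]] /= /funext gh.
case: _ / gh in h1 h2 *.
(* The morphism axioms are propositions, so agreement of the underlying functions suffices. *)
by rewrite (Prop_irrelevance h1 g1) (Prop_irrelevance h2 g2).
Qed.

Lemma gal_mul1g (g : GalQ) : gal_mul gal_one g = g.
Proof. exact: gal_ext. Qed.

Lemma gal_mulg1 (g : GalQ) : gal_mul g gal_one = g.
Proof. exact: gal_ext. Qed.

Lemma gal_mulgV (g : GalQ) : gal_mul g (gal_inv g) = gal_one.
Proof. by apply: gal_ext => x /=; rewrite algC_invautK. Qed.

Lemma gal_inv1 : gal_inv gal_one = gal_one.
Proof. by rewrite -[LHS]gal_mul1g gal_mulgV. Qed.

(** * Congruences modulo a prime of the algebraic integers above p *)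

Section PrimeIdeal.
Variables (p : nat) (P : {pred algC}).
Hypotheses (p_prime : prime p) (PP : prime_ideal_above p P).

Lemma prime_idealMl x y : x \in Aint -> y \in P -> x * y \in P.
Proof. by move=> xA yP; apply: (pa_mul PP). Qed.

Lemma prime_idealMr x y : x \in P -> y \in Aint -> x * y \in P.
Proof. by move=> xP yA; rewrite mulrC prime_idealMl. Qed.

Lemma prime_ideal0 : 0 \in P.
Proof. by rewrite -(mul0r p%:R) prime_idealMl ?rpred0 ?(pa_above PP). Qed.

Lemma prime_idealN x : x \in P -> - x \in P.
Proof. by move=> xP; rewrite -mulN1r prime_idealMl ?rpredN ?rpred1. Qed.

Lemma prime_idealD x y : x \in P -> y \in P -> x + y \in P.
Proof. by move=> xP yP; apply: (pa_add PP). Qed.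

Lemma prime_idealB x y : x \in P -> y \in P -> x - y \in P.
Proof. by move=> xP yP; rewrite prime_idealD ?prime_idealN. Qed.

Lemma prime_ideal_sum (I : Type) (r : seq I) (F : I -> algC) :
  (forall i, F i \in P) -> \sum_(i <- r) F i \in P.
Proof.
move=> FP; elim/big_ind: _ => // [|x y]; [exact: prime_ideal0|exact: prime_idealD].
Qed.

Lemma prime_ideal_prod (I : Type) (r : seq I) (F : I -> algC) :
  (forall i, F i \in Aint) -> \prod_(i <- r) F i \in P ->
  exists i, F i \in P.
Proof.
move=> FA; elim: r => [|i r IHr].
  by rewrite big_nil (negPf (pa_proper PP)).
rewrite big_cons => FP.
have rA : \prod_(j <- r) F j \in Aint by exact: rpred_prod.
by case/orP: (pa_prime PP (FA i) rA FP) => [FiP|/IHr//]; exists i.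
Qed.

(** If p does not divide m, a Bezout relation between p and m would put 1 in [P]. *)
Lemma prime_ideal_dvd (m : int) : (m%:~R \in P) = (p %| m)%Z.
Proof.
apply/idP/idP => [mP|/dvdzP[n ->]]; last first.
  by rewrite rmorphM prime_idealMl ?Aint_int ?(pa_above PP).
apply/negPn/negP => p'm.
have [u [v uv]] := Bezoutz p%:Z m.
have g1 : gcdz p%:Z m = 1.
  by congr Posz; apply/eqP; rewrite -[_ == _]/(coprime _ _) prime_coprime.
apply/negP: (pa_proper PP); rewrite negbK.
rewrite -[1](rmorph1 (intr : int -> algC)) -g1 -uv rmorphD !rmorphM /=.
by rewrite prime_idealD // prime_idealMl ?Aint_int ?(pa_above PP).
Qed.

(** Modulo p, ['X^p - 'X] is the product of the ['X - x] over residues x. Evaluating an integral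
    lift of this identity at t puts the product of the t - x in [P], and primality of [P] selects a
    factor. *)
Lemma expp_fixed_int t : t \in Aint -> t ^+ p - t \in P ->
  exists i : int, t - i%:~R \in P.
Proof.
move=> tA tP.
pose L : {poly int} := \prod_(x : 'F_p) ('X - (x%:R)%:P).
pose Q := L - ('X^p - 'X).
have Q0 : map_poly intr Q = 0 :> {poly 'F_p}.
  rewrite rmorphB /= map_prod_XsubC rmorphB /= map_polyXn map_polyX.
  rewrite -[X in 'X^X](card_Fp p_prime) finField_genPoly.
  apply/eqP; rewrite subr_eq0; apply/eqP/eq_bigr => x _.
  by rewrite rmorph_nat natr_Zp.
have QP : (map_poly intr Q).[t] \in P.
  rewrite horner_coef; apply: prime_ideal_sum => i.
  apply: prime_idealMr; last exact: rpredX.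
  rewrite coef_map prime_ideal_dvd (dvdz_pcharf (pchar_Fp p_prime)).
  by have /polyP/(_ i)/eqP := Q0; rewrite coef_map coef0.
have [x xP] : exists x : 'F_p, t - x%:R \in P.
  apply: (prime_ideal_prod (r := index_enum _)) => [x|].
    by rewrite rpredB ?rpred_nat.
  rewrite -(subrK (t ^+ p - t) (\prod_x _)) prime_idealD //.
  move: QP; rewrite rmorphB /= map_prod_XsubC rmorphB /= map_polyXn map_polyX.
  rewrite !hornerE horner_prod; congr (_ - _ \in P).
  by apply: eq_bigr => x _; rewrite !hornerE rmorph_nat.
by exists (x : nat)%:Z.
Qed.

Lemma unity_root_Aint n z : (0 < n)%N -> z ^+ n = 1 -> z \in Aint.
Proof.
move=> n0 zn; apply: (Aint_unity_root n0).
by rewrite /root_of_unity rootE !hornerE zn subrr.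
Qed.

(** If w = x / y were not 1, then 1 + w + ... + w^(n-1) = 0; since w is 1 modulo [P], this would put
    n in [P]. For roots of unity of order prime to p, congruences thus become equalities. *)
Lemma unity_root_mod_inj n x y : ~~ (p %| n)%N ->
  x ^+ n = 1 -> y ^+ n = 1 -> x - y \in P -> x = y.
Proof.
case: n => [|n]; rewrite ?dvdn0 // => pn xn yn xyP.
have unityA := unity_root_Aint (ltn0Sn n).
have y0 : y != 0 by apply: contra_eq_neq yn => ->; rewrite expr0n eq_sym oner_neq0.
pose w := x / y.
have wn : w ^+ n.+1 = 1 by rewrite expr_div_n xn yn divr1.
have wP : w - 1 \in P.
  have ->: w - 1 = (x - y) * y ^+ n.
    by apply: (mulIf y0); rewrite -mulrA -exprSr yn mulr1 mulrBl mul1r divfK.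
  by rewrite prime_idealMr ?rpredX ?(unityA y).
apply/eqP; rewrite -(inj_eq (mulIf (invr_neq0 y0))) divff //; apply/negPn/negP => w1.
have sum0 : \sum_(i < n.+1) w ^+ i = 0.
  apply: (mulfI (x := w - 1)); first by rewrite subr_eq0.
  by rewrite -subrX1 wn subrr mulr0.
case/negP: pn; rewrite -[X in is_true X]/(p%:Z %| n.+1%:Z)%Z -prime_ideal_dvd.
have -> : (n.+1)%:~R = - \sum_(i < n.+1) (w ^+ i - 1) :> algC.
  by rewrite sumrB sum0 sumr_const card_ord sub0r opprK.
apply/prime_idealN/prime_ideal_sum => i.
rewrite subrX1 prime_idealMr //.
by rewrite rpred_sum // => j _; rewrite rpredX ?(unityA w).
Qed.

Lemma rootd_sqr d : rootd d * rootd d = d%:~R.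
Proof. by rewrite -expr2 sqrtCK. Qed.

Lemma rootd_Aint d : rootd d \in Aint.
Proof.
apply: (@root_monic_Aint ('X^2 - (d%:~R)%:P)).
- by rewrite rootE !hornerE expr2 rootd_sqr subrr.
- by rewrite monicXnsubC.
- by rewrite polyOverXnsubC intr_int.
Qed.

Lemma gal_rootd (g : GalQ) d : g (rootd d) = rootd d \/ g (rootd d) = - rootd d.
Proof.
have /eqP : g (rootd d) ^+ 2 = rootd d ^+ 2.
  by rewrite !expr2 -rmorphM rootd_sqr rmorph_int.
by rewrite eqf_sqr => /orP[]/eqP; [left|right].
Qed.

Hypothesis p_odd : (2 < p)%N.

Lemma prime_ideal_cancel2 x : x \in Aint -> x *+ 2 \in P -> x \in P.
Proof.
move=> xA; rewrite -mulr_natl => /(pa_prime PP (rpred_nat _ 2) xA) /orP[|//].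
by rewrite -[2]/(2%:~R) prime_ideal_dvd -[(_ %| _)%Z]/(p %| 2)%N gtnNdvd.
Qed.

(** * Frobenius, decomposition and inertia on roots of unity and on the square root of d *)

Section Frobenius.
Variables (F : GalQ).
Hypothesis FP : arithmetic_frobenius p P F.

Lemma frobenius_fixed_int t : t \in Aint -> F t = t ->
  exists i : int, t - i%:~R \in P.
Proof.
move=> tA Ft; apply: expp_fixed_int => //.
by have := prime_idealN (FP.2 t tA); rewrite Ft opprB.
Qed.

(** Modulo [P], t is a rational integer i; g fixes i and preserves [P]. *)
Lemma frobenius_fixed_decomposition (g : GalQ) t : decomposition P g ->
  t \in Aint -> F t = t -> g t - t \in P.
Proof.
move=> gP tA /(frobenius_fixed_int tA)[i tiP].
have -> : g t - t = g (t - i%:~R) - (t - i%:~R).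
  by rewrite rmorphB rmorph_int; ring.
by rewrite prime_idealB ?gP.
Qed.

Lemma frobenius_unity_root n z : (0 < n)%N -> ~~ (p %| n)%N -> z ^+ n = 1 ->
  F z = z ^+ p.
Proof.
move=> n0 pn zn; apply: (unity_root_mod_inj pn).
- by rewrite -rmorphXn zn rmorph1.
- by rewrite exprAC zn expr1n.
- exact: FP.2 (unity_root_Aint n0 zn).
Qed.

(** Were the root fixed, it would be congruent to an integer i, making d a square modulo p. *)
Lemma frobenius_rootd d : nonsquare_unit p d -> F (rootd d) = - rootd d.
Proof.
move=> [_ nsq]; case: (gal_rootd F d) => // /(frobenius_fixed_int (rootd_Aint d)).
move=> [i riP]; case/negP: (nsq i); rewrite -prime_ideal_dvd.
have -> : (i ^+ 2 - d)%:~R = - ((rootd d + i%:~R) * (rootd d - i%:~R)).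
  by rewrite rmorphB rmorphXn /= -(rootd_sqr d); ring.
by rewrite prime_idealN // prime_idealMl ?rpredD ?rootd_Aint ?Aint_int.
Qed.

(* The residue field of Q(sqrt d) at [P] is F_(p^2), which contains the roots of
   unity of order dividing p + 1.  Concretely, z + z^p and (z - z^p) sqrt d are
   fixed by Frobenius, hence by every decomposition element modulo [P]. *)
Lemma decomposition_unity_root (g : GalQ) d n z : nonsquare_unit p d ->
  decomposition P g -> (0 < n)%N -> ~~ (p %| n)%N -> z ^+ n = 1 -> z ^+ p.+1 = 1 ->
  g z = if g (rootd d) == rootd d then z else z ^+ p.
Proof.
move=> dns gP n0 pn zn zp.
have zA := unity_root_Aint n0 zn.
have Fz := frobenius_unity_root n0 pn zn.
(* Frobenius swaps z and z^p, because p^2 = (p + 1)(p - 1) + 1 and z^(p+1) = 1. *)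
have Fzp : F (z ^+ p) = z.
  have pp : (p * p = p.+1 * p.-1 + 1)%N.
    by case: p p_odd => // m _ /=; rewrite mulSn mulnS mulSn; lia.
  by rewrite rmorphXn /= Fz -exprM pp exprD exprM zp expr1n mul1r.
have rA := rootd_Aint d.
have tP : g (z + z ^+ p) - (z + z ^+ p) \in P.
  apply: frobenius_fixed_decomposition => //; first by rewrite rpredD ?rpredX.
  by rewrite rmorphD /= Fz Fzp addrC.
have uP : g ((z - z ^+ p) * rootd d) - (z - z ^+ p) * rootd d \in P.
  apply: frobenius_fixed_decomposition => //.
    by rewrite rpredM ?rpredB ?rpredX.
  by rewrite rmorphM rmorphB /= Fz Fzp frobenius_rootd //; ring.
have gzA : g z \in Aint by rewrite Aint_aut.
have gzn : g z ^+ n = 1 by rewrite -rmorphXn zn rmorph1.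
have rNP : rootd d \notin P.
  apply/negP => /(prime_idealMl rA); rewrite rootd_sqr prime_ideal_dvd.
  by case: dns => /negPf ->.
have cancel_r x : x \in Aint -> x * rootd d \in P -> x \in P.
  by move=> xA /(pa_prime PP xA rA); rewrite (negPf rNP) orbF.
case: ifPn => [/eqP gr|gr].
  apply: (unity_root_mod_inj pn) => //.
  apply: prime_ideal_cancel2; first exact: rpredB.
  (* Twice the difference separates into the part controlled by [tP] and one that lies in [P] after
     multiplication by [rootd d], by [uP]; both factors 2 and [rootd d] can be cancelled. *)
  have -> : (g z - z) *+ 2 = (g (z + z ^+ p) - (z + z ^+ p)) +
     ((g z - g z ^+ p) - (z - z ^+ p)) by rewrite rmorphD rmorphXn /=; ring.
  rewrite prime_idealD //; apply: cancel_r; first by rewrite !rpredB ?rpredX.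
  by rewrite mulrBl; move: uP; rewrite rmorphM rmorphB rmorphXn /= gr.
have {}gr : g (rootd d) = - rootd d by case: (gal_rootd g d) gr => ->; rewrite ?eqxx.
apply: (unity_root_mod_inj pn) => //; first by rewrite exprAC zn expr1n.
apply: prime_ideal_cancel2; first by rewrite rpredB ?rpredX.
(* The same splitting, with the sign change of [rootd d] under g exchanging the roles of z and
   z^p. *)
have -> : (g z - z ^+ p) *+ 2 = (g (z + z ^+ p) - (z + z ^+ p)) -
   - ((g z - g z ^+ p) + (z - z ^+ p)) by rewrite rmorphD rmorphXn /=; ring.
rewrite prime_idealB //; apply: cancel_r.
  by rewrite rpredN rpredD ?rpredB ?rpredX.
rewrite mulNr mulrDl opprD -mulrN.
by move: uP; rewrite rmorphM rmorphB rmorphXn /= gr.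
Qed.

End Frobenius.

Lemma inertia_unity_root (g : GalQ) n z : inertia P g ->
  (0 < n)%N -> ~~ (p %| n)%N -> z ^+ n = 1 -> g z = z.
Proof.
move=> [_ gI] n0 pn zn; apply: (unity_root_mod_inj pn) => //.
  by rewrite -rmorphXn zn rmorph1.
exact/gI/(unity_root_Aint n0 zn).
Qed.

(** A sign change would put 2 [rootd d] in [P], hence d as well, although p is odd and prime to
    d. *)
Lemma inertia_rootd (g : GalQ) d : ~~ (p %| d)%Z -> inertia P g ->
  g (rootd d) = rootd d.
Proof.
move=> pd [_ /(_ _ (rootd_Aint d))]; case: (gal_rootd g d) => // ->.
rewrite -opprD -mulr2n => /prime_idealN; rewrite opprK.
move=> /(prime_ideal_cancel2 (rootd_Aint d)) /(prime_idealMl (rootd_Aint d)).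
by rewrite rootd_sqr prime_ideal_dvd (negPf pd).
Qed.

End PrimeIdeal.

(** * Survival of the order of chi under reduction *)

(** If y were not 1, then 1 + y + ... + y^(r-1) = 0 would reduce to r = 0 in [k]. *)
Lemma idomain_red_unity_inj (O : idomainType) (k : nzRingType)
    (red : {rmorphism O -> k}) (r : nat) (y : O) :
  r%:R != 0 :> k -> y ^+ r = 1 -> red y = 1 -> y = 1.
Proof.
move=> r0 yr ry; have /eqP := subrX1 y r.
rewrite yr subrr eq_sym mulf_eq0 subr_eq0 => /orP[/eqP//|/eqP s0].
move: r0; have := congr1 red s0; rewrite rmorph_sum rmorph0.
under eq_bigr do rewrite rmorphXn /= ry expr1n.
by rewrite sumr_const card_ord => ->; rewrite eqxx.
Qed.

Lemma has_order_red_sqr (O : idomainType) (k : nzRingType)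
    (red : {rmorphism O -> k}) (G : set GalQ) (chi : GalQ -> O) (r : nat) :
  (2 < r)%N -> r%:R != 0 :> k -> has_order_on G chi r ->
  exists2 g, G g & red (chi g) ^+ 2 != 1.
Proof.
move=> r2 r0 [_ chir /(_ 2)]; rewrite r2 => /(_ isT)[g Gg chig2].
exists g => //; apply: contra_neq chig2 => chig2.
apply: (idomain_red_unity_inj (red := red) r0); last by rewrite rmorphXn.
by rewrite exprAC chir // expr1n.
Qed.

Lemma unramified_supercuspidal_nonsquare (O : idomainType) (pi : O)
    (P : {pred algC}) (p : nat) (d : int) (chi : GalQ -> O) :
  unramified_supercuspidal pi P p d chi -> nonsquare_unit p d.
Proof.
case=> [[]//|[-> -> _]]; split=> // x.
(* For p = 3 and d = -1, the residues modulo 3 show that x^2 + 1 has no root. *)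
rewrite (dvdz_pcharf (pchar_Fp (isT : prime 3))) opprK rmorphD rmorphXn /=.
by case: (x%:~R) => [[|[|[|]]]].
Qed.

Lemma natr_neq0_pchar_ge5 (k : nzRingType) (l r : nat) :
  (5 <= l)%N -> l \in [pchar k] -> (r %| 12)%N -> r%:R != 0 :> k.
Proof.
move=> l5 lk r12; rewrite -(dvdn_pcharf lk); apply/negP => /dvdn_trans/(_ r12).
have lp := pcharf_prime lk.
(* A prime dividing 12 = 3 * 4 divides 3 or 4, hence is smaller than 5. *)
by rewrite (Euclid_dvdM 3 4 lp) !gtnNdvd // (leq_trans _ l5).
Qed.

Lemma unramified_supercuspidal_sqr (O : idomainType) (pi : O) (k : nzRingType)
    (red : {rmorphism O -> k}) (P : {pred algC}) (p d : _) (chi : GalQ -> O) l :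
  prime p -> prime_ideal_above p P -> (2 < p)%N ->
  (5 <= l)%N -> l \in [pchar k] ->
  unramified_supercuspidal pi P p d chi ->
  exists2 g, inertia P g & red (chi g) ^+ 2 != 1.
Proof.
move=> pp hP p2 l5 lk sc; have [pd _] := unramified_supercuspidal_nonsquare sc.
have main c r chi0 : (r \in [:: 3; 4; 6])%N -> tau_sc pi P d c r chi0 ->
    exists2 g, inertia P g & red (chi0 g) ^+ 2 != 1.
  move=> hr [_ _]; apply: has_order_red_sqr.
    by move: hr; rewrite !inE => /or3P[] /eqP ->.
  apply: natr_neq0_pchar_ge5 l5 lk _.
  by move: hr; rewrite !inE => /or3P[] /eqP ->.
case: sc => [[_ _ [e [he _]]]|[_ _ []]]; try exact: main.
move=> [chi0 /main chi0P chiE].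
have [//|g gI chig] := chi0P; exists g => //.
(* The twist by [quad_char] changes chi by a sign only, which disappears in the square. *)
rewrite chiE; last exact: (conj gI.1 (inertia_rootd pp hP p2 pd gI)).
by rewrite /quad_char; case: ifP; rewrite ?mulr1 // mulrN1 rmorphN sqrrN.
Qed.

(** * The mod l cyclotomic character at p *)

Section Cyclotomic.
Variables (p l : nat) (P : {pred algC}) (k : nzRingType) (eps : GalQ -> k).
Hypotheses (p_prime : prime p) (hP : prime_ideal_above p P).
Hypotheses (l_prime : prime l) (pl : p != l) (heps : mod_cyclotomic l eps).

Let l_gt0 : (0 < l)%N := prime_gt0 l_prime.
Let p'l : ~~ (p %| l)%N.
Proof. by rewrite dvdn_prime2. Qed.

Lemma cyclotomic_inertia g : inertia P g -> eps g = 1.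
Proof.
move=> gI; have [z zl] := C_prim_root_exists l_gt0.
apply: (heps (m := 1) zl); rewrite expr1.
exact: (inertia_unity_root p_prime hP gI l_gt0 p'l (prim_expr_order zl)).
Qed.

Lemma cyclotomic_frobenius g : arithmetic_frobenius p P g -> eps g = p%:R.
Proof.
move=> gF; have [z zl] := C_prim_root_exists l_gt0.
apply: (heps zl).
exact: (frobenius_unity_root p_prime hP gF l_gt0 p'l (prim_expr_order zl)).
Qed.

(** As l divides p + 1, an l-th root of unity z satisfies z^(p+1) = 1, so g sends it to z or z^p
    according to its action on [rootd d]; and p = -1 in [k]. *)
Lemma cyclotomic_decomposition F d g : (2 < p)%N -> l \in [pchar k] ->
  arithmetic_frobenius p P F -> nonsquare_unit p d -> (l %| p.+1)%N ->
  decomposition P g -> eps g = quad_char k d g.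
Proof.
move=> p2 lk hF hd lp gP; have [z zl] := C_prim_root_exists l_gt0.
have zp : z ^+ p.+1 = 1 by apply/eqP; rewrite -(prim_order_dvd zl).
have := decomposition_unity_root p_prime hP p2 hF hd gP l_gt0 p'l (prim_expr_order zl) zp.
rewrite /quad_char; case: ifP => _ gz; first exact: (heps (m := 1) zl).
by rewrite (heps zl gz); apply/eqP; rewrite -subr_eq0 opprK natr1 -(dvdn_pcharf lk).
Qed.
End Cyclotomic.


(** * Matrices of the induced representation *)

Lemma ord2_ind (Q : 'I_2 -> Prop) : Q 0 -> Q 1 -> forall i, Q i.
Proof.
move=> Q0 Q1 [[|[|//]] lt_i2].
  by rewrite (_ : Ordinal _ = 0) //; apply: val_inj.
by rewrite (_ : Ordinal _ = 1) //; apply: val_inj.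
Qed.

(** Conjugated by [B], this is the generator of [epsK_summand B]. *)
Definition sign_mx (k : nzRingType) : 'M[k]_2 :=
  diag_mx (\row_(j < 2) (if j == 0 then 1 else -1)).

(** Comparing entries kills those off the diagonal, where the two eigenvalues differ; trace zero
    makes the diagonal ones opposite. *)
Lemma commute_diag_traceless (k : fieldType) (v : 'rV[k]_2) (X : 'M[k]_2) :
  v 0 0 != v 0 1 -> \tr X = 0 -> X *m diag_mx v = diag_mx v *m X ->
  X = X 0 0 *: sign_mx k.
Proof.
move=> v01 trX /matrixP XC.
have X0 i j : v 0 i != v 0 j -> X i j = 0.
  have := XC i j; rewrite mul_mx_diag mul_diag_mx !mxE => Xij vij.
  apply/eqP; have := mulIf (x := X i j) _ (x1 := v 0 i) (x2 := v 0 j).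
  case: eqP => // _ /(_ isT); rewrite -Xij mulrC => /(_ erefl) /eqP.
  by rewrite (negPf vij).
move: trX; rewrite /mxtrace !big_ord_recl big_ord0 addr0 => /eqP.
rewrite addrC addr_eq0 => /eqP X11.
apply/matrixP; elim/ord2_ind => //; elim/ord2_ind;
  rewrite !mxE /= ?mulr1n ?mulr0n ?mulr1 ?mulr0 ?mulrN1 //.
- exact: X0.
- by apply: X0; rewrite eq_sym.
- by rewrite -X11; congr (X _ _); apply: val_inj.
Qed.

Section Induced.
Variables (A : comNzRingType) (d : int) (s : GalQ) (chi : GalQ -> A).
Hypotheses (d_neq0 : d != 0) (s_rootd : s (rootd d) = - rootd d).

Lemma rootd_neq_opp : (- rootd d == rootd d) = false.
Proof.
rewrite eq_sym -subr_eq0 opprK -mulr2n mulrn_eq0 /= sqrtC_eq0 intr_eq0.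
exact/negbTE.
Qed.

Lemma invaut_rootd : algC_invaut s (rootd d) = - rootd d.
Proof. by apply: (fmorph_inj s); rewrite algC_invautK rmorphN s_rootd opprK. Qed.

Lemma invaut_one x : algC_invaut gal_one x = x.
Proof. exact: (algC_invautK gal_one x). Qed.

Lemma induced_mx_diag (g : GalQ) : g (rootd d) = rootd d ->
  induced_mx d s chi g =
  diag_mx (\row_(j < 2) (if j == 0 then chi g else conj_char s chi g)).
Proof.
move=> gr; apply/matrixP; elim/ord2_ind; elim/ord2_ind; rewrite !mxE /=;
  rewrite ?gal_inv1 ?gal_mul1g ?gal_mulg1 /=.
- by rewrite invaut_one gr eqxx.
- by rewrite invaut_one s_rootd rmorphN gr rootd_neq_opp.
- by rewrite gr invaut_rootd rootd_neq_opp.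
- by rewrite s_rootd !rmorphN gr /= invaut_rootd opprK eqxx.
Qed.

(** Elements fixing [rootd d] have diagonal matrices, which commute with [sign_mx]; the others have
    antidiagonal matrices, which anticommute with it. *)
Lemma induced_mx_sign (g : GalQ) : induced_mx d s chi g *m sign_mx A =
  quad_char A d g *: (sign_mx A *m induced_mx d s chi g).
Proof.
rewrite /quad_char; have [gr|/eqP gr] := eqVneq (g (rootd d)).
  by rewrite scale1r induced_mx_diag // -[LHS]diag_mxC.
have {}gr : g (rootd d) = - rootd d by case: (gal_rootd g d) gr => ->; rewrite ?eqxx.
have diag0 : forall i, induced_mx d s chi g i i = 0.
  elim/ord2_ind; rewrite !mxE /= ?gal_inv1 ?gal_mul1g ?gal_mulg1 /=.
    by rewrite invaut_one gr rootd_neq_opp.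
  by rewrite s_rootd rmorphN gr opprK invaut_rootd rootd_neq_opp.
rewrite scaleN1r mul_mx_diag mul_diag_mx; move: (induced_mx _ _ _ _) diag0 => M M0.
apply/matrixP; elim/ord2_ind; elim/ord2_ind; rewrite !mxE ?M0 /=.
- by rewrite mul0r mulr0 oppr0.
- by rewrite mulrN1 mul1r.
- by rewrite mulr1 mulN1r opprK.
- by rewrite mul0r mulr0 oppr0.
Qed.

End Induced.

Lemma map_induced_mx (A A' : nzRingType) (red : {rmorphism A -> A'}) d s chi g :
  map_mx red (induced_mx d s chi g) = induced_mx d s (fun h => red (chi h)) g.
Proof. by apply/matrixP => i j; rewrite !mxE /=; case: ifP; rewrite ?rmorph0. Qed.

Lemma sign_mx_sqr (k : nzRingType) : sign_mx k *m sign_mx k = 1%:M.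
Proof.
rewrite mulmx_diag -diag_const_mx; congr diag_mx; apply/rowP => i; rewrite !mxE.
by case: ifP; rewrite ?mulr1 // mulrNN mulr1.
Qed.

(** * Determinant on inertia, change of basis and descent of scalars *)

Lemma representation_unit (A : comUnitRingType) (rho : GalQ -> 'M[A]_2) (g : GalQ) :
  is_representation rho -> rho g \in unitmx.
Proof.
by case=> rho1 rhoM; have := rhoM g (gal_inv g); rewrite gal_mulgV rho1 => /esym/mulmx1_unit[].
Qed.

(* det rho is the ell-adic cyclotomic character, which is unramified at [p]. *)
Lemma red_det_inertia (R : realType) (N : nat) (a : nat -> R[i]) (p ell : nat)
    (P : {pred algC}) (O : idomainType) (pi : O) (rho : GalQ -> 'M[O]_2)
    (k : nzRingType) (red : {rmorphism O -> k}) (g : GalQ) :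
  prime p -> prime_ideal_above p P -> prime ell -> p != ell ->
  ell \in [pchar k] -> attached_representation N a ell pi rho ->
  inertia P g -> red (\det (rho g)) = 1.
Proof.
move=> pp hP lp pl lk hrho gI; have [z zl] := C_prim_root_exists (prime_gt0 lp).
have p'l : ~~ (p %| ell)%N by rewrite dvdn_prime2.
have gz := inertia_unity_root pp hP gI (prime_gt0 lp) p'l (prim_expr_order zl).
rewrite -[ell]expn1 in zl; have [y] := ar_det hrho zl (gz : g z = z ^+ 1).
move=> /(congr1 red); rewrite rmorphB rmorphM !rmorph_nat expn1 (pcharf0 lk) mul0r.
by move/eqP; rewrite subr_eq0 => /eqP.
Qed.

(** Moves the invariance condition to the basis over [k'] in which the representation is explicitly
    induced, and clears the inverse of [rho g]. The converse uses injectivity of [map_mx iota]. *)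
Lemma conj_twisted_ad (k k' : fieldType) (iota : {rmorphism k -> k'})
    (B : 'M[k']_2) (eps : GalQ -> k) (rho : GalQ -> 'M[k]_2) (g : GalQ)
    (M : 'M[k']_2) (Y : 'M[k]_2) :
  B \in unitmx -> rho g \in unitmx -> map_mx iota (rho g) = B *m M *m invmx B ->
  twisted_ad eps rho g Y = Y <->
  iota (eps g) *: (M *m (invmx B *m map_mx iota Y *m B))
    = invmx B *m map_mx iota Y *m B *m M.
Proof.
move=> uB ur rM; have -> : M = invmx B *m map_mx iota (rho g) *m B.
  by rewrite rM !mulmxA mulVmx // mul1mx mulmxKV.
set r := map_mx iota (rho g); set y := map_mx iota Y.
have -> : invmx B *m r *m B *m (invmx B *m y *m B) = invmx B *m (r *m y) *m B.
  by rewrite !mulmxA mulmxK.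
have -> : invmx B *m y *m B *m (invmx B *m r *m B) = invmx B *m (y *m r) *m B.
  by rewrite !mulmxA mulmxK.
have -> : iota (eps g) *: (invmx B *m (r *m y) *m B) =
    invmx B *m map_mx iota (eps g *: (rho g *m Y)) *m B.
  by rewrite map_mxZ map_mxM -scalemxAr -scalemxAl.
rewrite -map_mxM /twisted_ad scalemxAl; split=> [tw|].
  by rewrite -[in RHS]tw mulmxKV.
move/(congr1 (fun Z => B *m Z *m invmx B)).
rewrite !mulmxA mulmxV // !mul1mx !mulmxK // => /map_mx_inj ->.
by rewrite mulmxK.
Qed.

(** The ratio of entries at a place where X is nonzero gives the factor already over [k], so a line
    over [k'] descends. *)
Lemma map_mx_colinear (k k' : fieldType) (iota : {rmorphism k -> k'}) (m n : nat)
    (X Y : 'M[k]_(m, n)) (c : k') :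
  X != 0 -> map_mx iota Y = c *: map_mx iota X -> exists a, Y = a *: X.
Proof.
move=> X0 /matrixP YX.
have /existsP[i /existsP[j Xij]] : [exists i, exists j, X i j != 0].
  apply: contraNT X0 => /existsPn Xn; apply/eqP/matrixP => i j.
  by have /existsPn/(_ j) := Xn i; rewrite negbK mxE => /eqP.
exists (Y i j / X i j); apply: (@map_mx_inj _ _ iota); apply/matrixP => i' j'.
rewrite YX map_mxZ !mxE fmorph_div; congr (_ * _).
by have := YX i j; rewrite !mxE => ->; rewrite mulfK // fmorph_eq0.
Qed.

Theorem proposition5p3
  (R : realType) (N : nat) (f : R[i] -> R[i]) (a : nat -> R[i])
  (E : weierstrass int) (p ell : nat) (S : seq nat)
  (kappa : finFieldType) (rhobar : GalQ -> 'M[kappa]_2)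
  (epsl : GalQ -> kappa)
  (k' : finFieldType) (iota : {rmorphism kappa -> k'})
  (O : idomainType) (pi : O) (red : {rmorphism O -> k'})
  (rho : GalQ -> 'M[O]_2)
  (P : {pred algC}) (Frob : GalQ) (d : int) (chi : GalQ -> O)
  (B : 'M[k']_2)
  (hf : normalized_newform2 N f a)
  (hE : minimal_elliptic_curve E)
  (hEN : conductor E N)
  (hEf : forall q, prime q -> a q = (trace_of_frobenius E q)%:~R)
  (hp : prime p) (hp3 : (3 <= p)%N)
  (hell : prime ell) (hell5 : (5 <= ell)%N) (hpell : p != ell)
  (hpN : (p ^ 2 %| N)%N) (hellN : ~~ (ell %| N)%N)
  (hord : exists2 m : int, a ell = m%:~R & ~~ (ell %| m)%Z)
  (hS : all prime S)
  (hSN : forall q, prime q -> (q %| N * ell)%N -> q \in S)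
  (hkappa : ell \in [pchar kappa])
  (hrhobar : is_representation rhobar)
  (hcont : discrete_continuous rhobar)
  (hunr : forall q, prime q -> q \notin S -> unramified_at rhobar q)
  (hodd : odd_representation rhobar)
  (hirr : absolutely_irreducible rhobar)
  (hepsl : mod_cyclotomic ell epsl)
  (hO : local_integers red pi)
  (hrho : attached_representation N a ell pi rho)
  (hres : residual_of iota red rho rhobar)
  (hP : prime_ideal_above p P)
  (hFrob : arithmetic_frobenius p P Frob)
  (hadd : additive_reduction E p)
  (hpot : potentially_good_reduction E P)
  (hsc : unramified_supercuspidal pi P p d chi)
  (hchi : continuous_character pi (decomposition_K P d) chi)
  (htype : has_inertial_type P d Frob rho chi)
  (hmin : forall c, conductor_exponent P chi c ->
     conductor_exponent P (fun g => red (chi g)) c)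
  (hB : B \in unitmx)
  (hind : forall g, decomposition P g ->
     map_mx iota (rhobar g)
       = B *m induced_mx d Frob (fun g => red (chi g)) g *m invmx B)
  (hchis : exists2 g, decomposition_K P d g
     & red (chi g) <> conj_char Frob (fun h => red (chi h)) g) :
  let H0 := H0_ad0 (decomposition P) epsl rhobar in
  [/\ (p != 1 %[mod ell])%Z && (p != -1 %[mod ell])%Z -> \dim H0 = 0%N,
      (p == -1 %[mod ell])%Z ->
        \dim H0 = 1%N /\
        exists X : 'M[kappa]_2,
          H0 = <[X]>%VS /\ map_mx iota X \in epsK_summand B
    & (p == 1 %[mod ell])%Z -> \dim H0 = 0%N].
Proof.
have hns := unramified_supercuspidal_nonsquare hsc.
have [pd _] := hns.
have d0 : d != 0 by apply: contraNneq pd => ->; rewrite dvdz0.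
have Fr := frobenius_rootd hp hP hFrob hns.
have ellk' : ell \in [pchar k'] by exact: rmorph_pchar hkappa.
have [g0 g0I u2] := unramified_supercuspidal_sqr red hp hP hp3 hell5 ellk' hsc.
have g0r := inertia_rootd hp hP hp3 pd g0I.
pose chibar h := red (chi h).
pose I := induced_mx d Frob chibar.
pose u := chibar g0; pose v := conj_char Frob chibar g0.
(* The intertwiner has nonzero determinant, so [rho] and the induced representation have equal
   determinants at [g0]. *)
have uv1 : u * v = 1.
  rewrite -(red_det_inertia red hp hP hell hpell ellk' hrho g0I).
  have [A A0 hA] := htype.
  have -> : \det (rho g0) = \det (induced_mx d Frob chi g0).
    by apply: (mulIf A0); rewrite -det_mulmx hA // det_mulmx mulrC.
  rewrite -det_map_mx map_induced_mx (induced_mx_diag _ d0 Fr g0r) det_diag.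
  by rewrite !big_ord_recl big_ord0 !mxE mulr1.
have uv : u != v.
  by apply: contraNneq u2 => uv; rewrite -[red _]/u expr2 {2}uv uv1.
have rbU g : rhobar g \in unitmx by exact: representation_unit.
pose S2 := B *m sign_mx k' *m invmx B.
have I0 : I g0 = diag_mx (\row_(j < 2) (if j == 0 then u else v)).
  exact: induced_mx_diag.
have inter Y g (gP : decomposition P g) :=
  conj_twisted_ad epsl Y hB (rbU g) (hind g gP).
(* The commutation at [g0] gives the multiple c; the equation at Frobenius gives c (p + 1) = 0. *)
have scalar Y : H0_invariant (decomposition P) epsl rhobar Y ->
    exists c, map_mx iota Y = c *: S2 /\ c * p.+1%:R = 0.
  move=> [trY YP]; pose Y' := invmx B *m map_mx iota Y *m B.
  have YE : map_mx iota Y = B *m Y' *m invmx B.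
    by rewrite /Y' !mulmxA mulmxV // mul1mx mulmxK.
  have Y'S : Y' = Y' 0 0 *: sign_mx k'.
    apply: (commute_diag_traceless (v := \row_(j < 2) (if j == 0 then u else v))).
    - by rewrite !mxE.
    - by rewrite /Y' mxtrace_mulC mulmxA mulmxV // mul1mx trace_map_mx trY rmorph0.
    - rewrite -I0; have /(inter _ _ g0I.1) := YP _ g0I.1.
      by rewrite (cyclotomic_inertia hp hP hell hpell hepsl g0I) rmorph1 scale1r.
  exists (Y' 0 0); split.
    by rewrite YE {1}Y'S -scalemxAr -scalemxAl.
  have /(inter _ _ hFrob.1) := YP _ hFrob.1.
  rewrite (cyclotomic_frobenius hp hP hell hpell hepsl hFrob) rmorph_nat -/Y' -/I.
  set c := Y' 0 0 in Y'S *; rewrite Y'S -scalemxAr -scalemxAl induced_mx_sign //.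
  (* Since the Frobenius matrix anticommutes with [sign_mx], the equation reads - p c = c, up to an
     invertible and hence nonzero matrix factor. *)
  rewrite /quad_char Fr rootd_neq_opp // scaleN1r !scalerN scalerA => /eqP.
  rewrite -subr_eq0 -opprD -scalerDl oppr_eq0.
  have SI : sign_mx k' *m I Frob \in unitmx.
    rewrite unitmx_mul; apply/andP; split; first by have [] := mulmx1_unit (sign_mx_sqr k').
    have := rbU Frob; rewrite -(map_unitmx iota) (hind _ hFrob.1).
    by rewrite !unitmx_mul => /andP[/andP[]].
  have SI0 : sign_mx k' *m I Frob != 0.
    by apply: contraTneq SI => ->; rewrite unitmxE det0 unitr0.
  rewrite scaler_eq0 (negPf SI0) orbF => /eqP <-.
  by rewrite -natr1 mulrDr mulr1 mulrC.
(* This settles both vanishing cases, where ell does not divide p + 1. *)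
have vanish : ~~ (ell %| p.+1)%N -> \dim (H0_ad0 (decomposition P) epsl rhobar) = 0%N.
  move=> lp; apply/eqP; rewrite dimv_eq0 -subv0; apply/subvP => Y.
  move=> /H0_ad0P/scalar[c [Yc /eqP]]; rewrite mulf_eq0 -(dvdn_pcharf ellk') (negPf lp) orbF.
  by move=> /eqP c0; move: Yc; rewrite c0 scale0r memv0 => /eqP; rewrite map_mx_eq0.
have dvdE : (p == -1 %[mod ell])%Z = (ell %| p.+1)%N.
  by rewrite eqz_mod_dvd opprK -[(p%:Z + 1)]/((p + 1)%:Z) addn1.
move=> H0; rewrite dvdE; split.
- by case/andP => _; apply: vanish.
- move=> lp.
  (* In the induced basis this is diag(u - v, v - u), yet it has entries in [kappa]. *)
  pose X := rhobar g0 + rhobar g0 - (\tr (rhobar g0))%:M.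
  have XS : map_mx iota X = (u - v) *: S2.
    have -> : (u - v) *: S2 = B *m (I g0 + I g0 - (\tr (I g0))%:M) *m invmx B.
      rewrite /S2 scalemxAl scalemxAr; congr (_ *m _ *m _).
      rewrite I0 mxtrace_diag !big_ord_recl big_ord0.
      by apply/matrixP; elim/ord2_ind; elim/ord2_ind; rewrite !mxE /= ?mulr1n ?mulr0n; ring.
    rewrite mulmxBr mulmxDr mulmxBl mulmxDl -(hind _ g0I.1).
    rewrite mul_mx_scalar -scalemxAl mulmxV // scalemx1.
    rewrite map_mxB map_mxD map_scalar_mx -trace_map_mx (hind _ g0I.1).
    by rewrite mxtrace_mulC mulmxA mulVmx // mul1mx.
  have S2U : S2 \in unitmx.
    rewrite !unitmx_mul hB unitmx_inv hB andbT /=.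
    by have [] := mulmx1_unit (sign_mx_sqr k').
  have X0 : X != 0.
    apply: contraNneq uv => X0; move: XS; rewrite X0 map_mx0 => /esym/eqP.
    rewrite scaler_eq0 subr_eq0 => /orP[//|/eqP S20].
    by move: S2U; rewrite S20 unitmxE det0 unitr0.
  have XH : X \in H0.
    apply/H0_ad0P; split=> [|g gP].
      by rewrite raddfB /= mxtraceD mxtrace_scalar mulr2n subrr.
    apply/(inter _ _ gP).
    have -> : invmx B *m map_mx iota X *m B = (u - v) *: sign_mx k'.
      by rewrite XS -scalemxAr -scalemxAl /S2 !mulmxA mulVmx // mul1mx mulmxKV.
    (* Invariance holds because [epsl] equals the quadratic character, whose square is 1. *)
    rewrite -scalemxAr -scalemxAl (induced_mx_sign _ d0 Fr) !scalerA; congr (_ *: _).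
    rewrite (cyclotomic_decomposition hp hP hell hpell hepsl hp3 hkappa hFrob hns lp gP).
    by rewrite /quad_char; case: ifP => _; rewrite ?rmorphN rmorph1; ring.
  have H0X : H0 = <[X]>%VS.
    apply/eqP; rewrite eqEsubv -memvE XH andbT; apply/subvP => Y.
    move=> /H0_ad0P/scalar[c [Yc _]]; apply/vlineP.
    (* The ratio c / (u - v) is taken in [k']; colinearity then descends to [kappa]. *)
    apply: (map_mx_colinear (iota := iota) (c := c / (u - v)) X0).
    by rewrite XS scalerA divfK // subr_eq0.
  split; first by rewrite H0X dim_vline X0.
  exists X; split=> //.
  by rewrite XS; apply: memvZ; apply: memv_line.
(* If ell divided both p - 1 and p + 1, it would divide 2. *)
- move=> p1; apply: vanish; apply/negP => lp.
  have := p1; rewrite eqz_mod_dvd subzn ?prime_gt0 // => p1'.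
  have {}p1' : (ell %| p - 1)%N := p1'.
  have pE : p.+1 = (p - 1 + 2)%N by rewrite subn1 addn2 prednK ?prime_gt0.
  by move: lp; rewrite pE (dvdn_addr _ p1') gtnNdvd // (leq_trans _ hell5).
Qed.
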